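(* Let $k$ be a field and $R=k[x_1,\dots,x_n]$. Let $J,K\subseteq[n]=\{1,\dots,n\}$ be nonempty and let $a$ and $b$ be positive integers. Then $I=\mathfrak m_J^a\cap\mathfrak m_K^b\subset R$ is componentwise linear.
   Context: For a nonempty subset $J=\{j_1,\dots,j_t\}\subseteq[n]$, $\mathfrak m_J=(x_{j_1},\dots,x_{j_t})\subset R$. $R$ is standard graded. For a homogeneous ideal $I$, $(I_d)$ is the ideal of $R$ generated by all elements of $I$ of degree $d$. A homogeneous ideal generated in degree $d$ has a linear resolution if its graded Betti numbers satisfy $\beta_{i,j}=0$ for all $i\ge 0$ and $j\neq i+d$. A homogeneous ideal $I$ is componentwise linear if $(I_d)$ has a linear resolution for every $d$ (the zero ideal counts as having a linear resolution). *)

(* Defs.v *)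
From HB Require Import structures.
From mathcomp Require Import all_boot all_order all_algebra.
From mathcomp Require Export mpoly.
Set Implicit Arguments.
Unset Strict Implicit.
Unset Printing Implicit Defensive.
Import GRing.Theory.
Local Open Scope ring_scope.

Section Ideals.
Variables (k : fieldType) (n : nat).
Local Notation R := {mpoly k[n]}.

(* Ideals are Prop-valued predicates: the boolean ideals of ring_quotient
   require decidable membership and exclude the unit ideal. *)
Implicit Types (S I J : R -> Prop) (f g : R) (d : nat).

Definition ideal_gen S f : Prop :=
  exists2 s : seq (R * R),
    (forall c, c \in s -> S c.2) & f = \sum_(c <- s) c.1 * c.2.

Definition ideal_mul I J : R -> Prop :=
  ideal_gen (fun f => exists g h, [/\ I g, J h & f = g * h]).

Fixpoint ideal_pow I (a : nat) : R -> Prop :=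
  if a is a'.+1 then ideal_mul I (ideal_pow I a') else fun _ => True.

Definition ideal_cap I J : R -> Prop := fun f => I f /\ J f.

Definition var_ideal (J : {set 'I_n}) : R -> Prop :=
  ideal_gen (fun f => exists2 j, j \in J & f = 'X_j).

Definition is_ideal I : Prop :=
  [/\ I 0, forall f g, I f -> I g -> I (f + g)
    & forall f g, I g -> I (f * g)].

Definition homogeneous_ideal I : Prop :=
  is_ideal I /\ forall f d, I f -> I (pihomog mdeg d f).

(* (I_d), the ideal generated by the degree d forms of I. *)
Definition degree_ideal d I : R -> Prop :=
  ideal_gen (fun f => I f /\ f \is d.-homog).

Definition generated_in_degree d I : Prop :=
  forall f, I f <-> degree_ideal d I f.

(* F_i is the free module 'rV[R]_(res_rank i), whose p-th basis vector has
   degree res_deg i p; maps act on row vectors on the right, so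
   res_diff i : F_(i+1) -> F_i and res_aug : F_0 -> R. Degrees are naturals
   since graded submodules of R, and their syzygies, live in degrees >= 0. *)
Record free_complex := FreeComplex {
  res_rank : nat -> nat;
  res_deg  : forall i, 'I_(res_rank i) -> nat;
  res_diff : forall i, 'M[R]_(res_rank i.+1, res_rank i);
  res_aug  : 'cV[R]_(res_rank 0)
}.

(* Degree 0 maps: a matrix entry from R(-e) to R(-e') is a form of degree
   e - e', hence 0 when e < e'. *)
Definition graded_complex (F : free_complex) : Prop :=
  (forall p, res_aug F p 0 \is (res_deg p).-homog) /\
  (forall i (p : 'I_(res_rank F i.+1)) (q : 'I_(res_rank F i)),
     if (res_deg q <= res_deg p)%N
     then res_diff F i p q \is (res_deg p - res_deg q).-homog
     else res_diff F i p q == 0).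

Definition resolves (F : free_complex) I : Prop :=
  [/\ forall f, I f <-> exists v : 'rV_(res_rank F 0), f = (v *m res_aug F) 0 0,
      forall v : 'rV_(res_rank F 0),
        v *m res_aug F = 0 <-> exists w, v = w *m res_diff F 0
    & forall i (v : 'rV_(res_rank F i.+1)),
        v *m res_diff F i = 0 <-> exists w, v = w *m res_diff F i.+1].

Definition minimal_complex (F : free_complex) : Prop :=
  forall i p q, var_ideal setT (res_diff F i p q).

Definition minimal_graded_free_resolution (F : free_complex) I : Prop :=
  [/\ graded_complex F, resolves F I & minimal_complex F].

(* beta_{i,j}(I) = b: the number of summands R(-j) in the i-th module of a
   minimal graded free resolution of I. Such a resolution is unique up to
   isomorphism, so b does not depend on F. *)
Definition graded_betti I (i j b : nat) : Prop :=
  exists2 F, minimal_graded_free_resolution F I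
           & #|[set p : 'I_(res_rank F i) | res_deg p == j]| = b.

Definition linear_resolution d I : Prop :=
  [/\ homogeneous_ideal I, generated_in_degree d I
    & forall i j, j != (i + d)%N -> graded_betti I i j 0].

Definition componentwise_linear I : Prop :=
  homogeneous_ideal I /\ forall d, linear_resolution d (degree_ideal d I).

End Ideals.

Arguments var_ideal k {n} J _.

(* Main.v *)
Require Import Defs.
From Stdlib Require Import IndefiniteDescription.
From mathcomp Require Import all_boot all_order all_algebra.
From mathcomp Require Import zify.

(* The ideal (I_d) is generated by the monomials u of degree d with J-degree at
   least a and K-degree at least b. Order them by putting first those with
   fewer variables outside J :|: K, then with more variables in J :&: K, then
   with more variables in J :\: K, then the lexicographically larger ones. If
   v precedes u, then some u * x / y, with the exponent of x larger in v than
   in u, is again a generator and precedes u. So (I_d) has linear quotients: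
   the colon ideal of each generator by its predecessors is generated by
   variables.

   Whenever f_1, ..., f_m have linear quotients, choose for each variable x in
   the j-th colon ideal a relation x f_j = \sum_(l < j) c_l f_l with linear
   c_l. The syzygies x e_j - \sum_(l < j) c_l e_l generate all syzygies and,
   ordered lexicographically by (j, x), have linear quotients again, the colon
   ideal at (j, x) being generated by the y < x in the j-th one. Iterating this
   builds a resolution all of whose matrices are linear. *)

Set Implicit Arguments.
Unset Strict Implicit.
Unset Printing Implicit Defensive.
Import Order.TTheory GRing.Theory.
Local Open Scope ring_scope.

(** * Monomial ideals, powers of variable ideals and degree components *)

Section MonomialIdeals.
Variables (k : fieldType) (n : nat).
Local Notation R := {mpoly k[n]}.
Implicit Types (S L : R -> Prop) (f g : R) (m u : 'X_{1..n}).
Implicit Types (P : 'X_{1..n} -> Prop) (C D : {set 'I_n}).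

Lemma ideal_gen_ideal S : is_ideal (ideal_gen S).
Proof.
split.
- by exists [::]; rewrite ?big_nil.
- move=> f g [s hs ->] [t ht ->]; exists (s ++ t); last by rewrite big_cat.
  by move=> c; rewrite mem_cat => /orP[/hs|/ht].
- move=> f g [s hs ->]; exists [seq (f * c.1, c.2) | c <- s].
    by move=> c /mapP[e /hs he ->].
  by rewrite big_map mulr_sumr; apply: eq_bigr => c _ /=; rewrite mulrA.
Qed.

Lemma sub_ideal_gen S f : S f -> ideal_gen S f.
Proof.
move=> Sf; exists [:: (1, f)]; last by rewrite big_seq1 mul1r.
by move=> c; rewrite inE => /eqP->.
Qed.

Lemma ideal_gen_sub S L f :
  is_ideal L -> (forall g, S g -> L g) -> ideal_gen S f -> L f.
Proof.
move=> [L0 LD LM] SL [s hs ->]; rewrite big_seq.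
by apply: big_ind => // c /hs /SL; apply: LM.
Qed.

(** For upward closed [P] this is the ideal spanned by the monomials in [P]; testing supports turns
    ideal membership into conditions on exponents. *)
Definition monomial_ideal P f := forall m, m \in msupp f -> P m.

Definition upward_closed P := forall m u, P u -> P (m + u)%MM.

Lemma monomial_ideal_ideal P : upward_closed P -> is_ideal (monomial_ideal P).
Proof.
move=> upP; split=> [m|f g hf hg m|f g hg m].
- by rewrite msupp0.
- by move/msuppD_le; rewrite mem_cat => /orP[/hf|/hg].
- by move/msuppM_le/allpairsP => [[m1 m2] /= [_ /hg h ->]]; apply: upP.
Qed.

Lemma monomial_ideal_homogeneous P :
  upward_closed P -> homogeneous_ideal (monomial_ideal P).
Proof.
move=> upP; split=> [|f d hf]; first exact: monomial_ideal_ideal.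
have [L0 LD LM] := monomial_ideal_ideal upP.
rewrite pihomogE big_seq_cond; apply: big_ind => // m /andP[/hf Pm _].
by move=> m' /msuppZ_le; rewrite msuppX inE => /eqP->.
Qed.

Lemma monomial_ideal_sub P L f :
  is_ideal L -> (forall m, P m -> L 'X_[m]) -> monomial_ideal P f -> L f.
Proof.
move=> [L0 LD LM] PL hf; rewrite (mpolyE f) big_seq.
by apply: big_ind => // m /hf /PL; rewrite -mul_mpolyC; apply: LM.
Qed.

Lemma monomial_idealX P m : monomial_ideal P 'X_[m] <-> P m.
Proof.
split=> [h|Pm m']; first by apply: h; rewrite msuppX inE.
by rewrite msuppX inE => /eqP->.
Qed.

Definition subdeg C m := (\sum_(i in C) m i)%N.

Lemma subdegD C m u : subdeg C (m + u)%MM = (subdeg C m + subdeg C u)%N.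
Proof.
by rewrite /subdeg -big_split; apply: eq_bigr => i _; rewrite mnmDE.
Qed.

Lemma subdegU C i : subdeg C U_(i)%MM = (i \in C).
Proof.
rewrite /subdeg; under eq_bigr do rewrite mnm1E.
rewrite big_mkcond (bigD1 i) //= eqxx big1 => [|j].
  by rewrite addn0; case: (i \in C).
by rewrite eq_sym => /negPf->; case: ifP.
Qed.

Lemma subdegID D C m :
  subdeg C m = (subdeg (C :&: D) m + subdeg (C :\: D) m)%N.
Proof. exact: big_setID. Qed.

Lemma subdegT m : subdeg setT m = mdeg m.
Proof. by rewrite mdegE; apply: eq_bigl => i; rewrite inE. Qed.

Lemma subdegC C m : (subdeg C m + subdeg (~: C) m)%N = mdeg m.
Proof. by rewrite -subdegT (subdegID C setT) setTI setTD. Qed.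

Lemma subdeg_gt0 C m : (0 < subdeg C m)%N -> exists2 i, i \in C & (0 < m i)%N.
Proof.
rewrite lt0n sum_nat_eq0 => /forall_inPn[i iC]; rewrite -lt0n => h.
by exists i.
Qed.

Lemma subdeg_lt C m u :
  (subdeg C m < subdeg C u)%N -> exists2 i, i \in C & (m i < u i)%N.
Proof.
move=> h; case: (pickP [pred i | (i \in C) && (m i < u i)%N]) => [i /andP[]|h'].
  by exists i.
move: h; rewrite ltnNge leq_sum // => i iC.
by rewrite leqNgt; have := h' i; rewrite /= iC /= => ->.
Qed.

Lemma mnm_subK1 m i : (0 < m i)%N -> (m - U_(i) + U_(i))%MM = m.
Proof. by move=> h; rewrite submK // lep1mP -lt0n. Qed.

Lemma var_idealE C f :
  var_ideal k C f <->
  monomial_ideal (fun m => exists2 i, i \in C & (0 < m i)%N) f.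
Proof.
split.
  apply: ideal_gen_sub => [|_ [j jC ->]].
    apply: monomial_ideal_ideal => m u [i iC h]; exists i => //.
    by rewrite mnmDE ltn_addl.
  by apply/monomial_idealX; exists j => //; rewrite mnm1E eqxx.
have [_ _ LM] := ideal_gen_ideal (fun f => exists2 j, j \in C & f = 'X_j :> R).
apply: monomial_ideal_sub => [|m [i iC h]]; first exact: ideal_gen_ideal.
by rewrite -(mnm_subK1 h) mpolyXD; apply: LM; apply: sub_ideal_gen; exists i.
Qed.

Lemma ideal_pow_varE C a f :
  ideal_pow (var_ideal k C) a f <->
  monomial_ideal (fun m => (a <= subdeg C m)%N) f.
Proof.
have up b : upward_closed (fun m => (b <= subdeg C m)%N).
  by move=> m u h; rewrite subdegD (leq_trans h) ?leq_addl.
elim: a f => [|a IH] f /=; first by split.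
split.
  apply: ideal_gen_sub => [|_ [g [h [hg hh ->]]]].
    exact: monomial_ideal_ideal.
  move=> m /msuppM_le/allpairsP => -[[m1 m2] /= [m1g m2h ->]].
  have [i iC i0] := (var_idealE C g).1 hg _ m1g.
  have := (IH h).1 hh _ m2h; rewrite subdegD -(mnm_subK1 i0) subdegD subdegU iC.
  lia.
apply: monomial_ideal_sub => [|m hm]; first exact: ideal_gen_ideal.
have [|i iC i0] := @subdeg_gt0 C m; first by apply: leq_trans hm.
apply: sub_ideal_gen; exists 'X_i, 'X_[m - U_(i)]; split.
- by apply: sub_ideal_gen; exists i.
- apply/IH/monomial_idealX.
  by move: hm; rewrite -{1}(mnm_subK1 i0) subdegD subdegU iC addn1.
- by rewrite -mpolyXD addmC mnm_subK1.
Qed.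

(** Each term of a degree [d] form of [L] is itself a degree [d] monomial of [L], so monomials
    suffice as generators. *)
Lemma degree_idealE P d L f : upward_closed P ->
    (forall g, L g <-> monomial_ideal P g) ->
  degree_ideal d L f <->
  monomial_ideal (fun m => exists u, [/\ mdeg u = d, P u & (u <= m)%MM]) f.
Proof.
move=> upP LP; split.
  apply: ideal_gen_sub => [|g [/LP Pg /dhomogP dg] m mg].
    apply: monomial_ideal_ideal => m u [v [dv Pv vu]]; exists v; split=> //.
    exact: lepm_trans vu (lem_addl _ _).
  by exists m; rewrite dg //; split=> //; [apply: Pg | apply: lepm_refl].
have [_ _ LM] := ideal_gen_ideal (fun f => L f /\ f \is d.-homog).
apply: monomial_ideal_sub => [|m [u [du Pu um]]]; first exact: ideal_gen_ideal.
rewrite -(submK um) mpolyXD; apply: LM; apply: sub_ideal_gen; split.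
  exact/LP/monomial_idealX.
by rewrite dhomogX; apply/eqP.
Qed.

Lemma degree_ideal_generated d L : generated_in_degree d (degree_ideal d L).
Proof.
move=> f; split; apply: ideal_gen_sub; try exact: ideal_gen_ideal.
  by move=> g [Lg dg]; apply: sub_ideal_gen; split=> //; apply: sub_ideal_gen.
by move=> g [].
Qed.

(** Used to cut a relation among forms of one degree down to the part whose coefficients have degree
    [e]. *)
Lemma pihomogM_homog d e f g : g \is d.-homog ->
  pihomog mdeg (e + d) (f * g) = pihomog mdeg e f * g.
Proof.
move=> dg; rewrite [f in LHS]mpolyE [f in RHS]mpolyE mulr_suml !linear_sum.
rewrite mulr_suml; apply: eq_bigr => m _.
rewrite -scalerAl !linearZ /= -scalerAl pihomogX; congr (_ *: _).
case: eqP => [<-|/eqP ne].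
  by rewrite pihomog_dE // dhomogM // dhomogX.
rewrite mul0r; apply: (@pihomog_ne0 _ _ _ (mdeg m + d)%N).
  by rewrite eqn_add2r.
by rewrite dhomogM // dhomogX.
Qed.

End MonomialIdeals.

(** * Linear quotients and their inheritance by syzygies *)

Section LinearQuotients.
Variables (k : fieldType) (n : nat).
Local Notation R := {mpoly k[n]}.

Lemma var_ideal_ideal (C : {set 'I_n}) : is_ideal (var_ideal k C).
Proof. exact: ideal_gen_ideal. Qed.

Lemma var_ideal_sum (C : {set 'I_n}) (f : R) : var_ideal k C f ->
  exists h : 'I_n -> R, f = \sum_(x in C) h x * 'X_x.
Proof.
apply: (@ideal_gen_sub _ _ _
  (fun f => exists h : 'I_n -> R, f = \sum_(x in C) h x * 'X_x))
  => [|_ [j jC ->]]; last first.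
  exists (fun x => (x == j)%:R).
  rewrite (bigD1 j) //= eqxx mul1r big1 ?addr0 //.
  by move=> i /andP[_ /negPf->]; rewrite mul0r.
split=> [|_ _ [h1 ->] [h2 ->]|g _ [h ->]].
- by exists (fun=> 0); rewrite big1 // => i _; rewrite mul0r.
- exists (fun x => h1 x + h2 x); rewrite -big_split.
  by apply: eq_bigr => i _; rewrite mulrDl.
- exists (fun x => g * h x); rewrite mulr_sumr.
  by apply: eq_bigr => i _; rewrite mulrA.
Qed.

(** Multiplication by ['X_x] changes only the exponent of [x], so a variable of [C] dividing a term
    of [f * 'X_x] already divides the corresponding term of [f]. *)
Lemma var_ideal_colon (C : {set 'I_n}) x (f : R) : x \notin C ->
  var_ideal k C (f * 'X_x) -> var_ideal k C f.
Proof.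
move=> xC /var_idealE h; apply/var_idealE => m mf.
have [|i iC] := h (U_(x) + m)%MM.
  by rewrite (perm_mem (msuppMX _ _)); apply/mapP; exists m.
rewrite mnmDE mnm1E; case: eqP => [xi|_]; last by exists i.
by rewrite xi iC in xC.
Qed.

Lemma row_colon_ideal m r (A : 'M[R]_(m, r)) (v : 'rV_r) (P : pred 'I_m) :
  is_ideal (fun g => exists2 c : 'rV_m, (forall l, P l -> c 0 l = 0)
                                      & g *: v = c *m A).
Proof.
split=> [|f g [c c0 cA] [c' c'0 c'A]|f g [c c0 cA]].
- by exists 0 => [l _|]; rewrite ?mxE // scale0r mul0mx.
- exists (c + c') => [l hl|]; first by rewrite mxE c0 ?c'0 ?addr0.
  by rewrite scalerDl mulmxDl cA c'A.
- exists (f *: c) => [l hl|]; first by rewrite mxE c0 ?mulr0.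
  by rewrite -scalerA cA scalemxAl.
Qed.

(** Rows take the place of ring elements so that the notion also applies to syzygy matrices. The
    rank [rk] replaces the index order, so syzygies can be reordered without permuting rows. *)
Definition variable_colons m r (A : 'M[R]_(m, r)) (rk : 'I_m -> nat)
    (V : 'I_m -> {set 'I_n}) : Prop :=
  forall j g,
    var_ideal k (V j) g <->
    exists2 c : 'rV_m, (forall l, (rk j <= rk l)%N -> c 0 l = 0)
                     & g *: row j A = c *m A.

Definition has_linear_quotients e m r (A : 'M[R]_(m, r)) : Prop :=
  (forall i j, A i j \is e.-homog) /\
  exists2 rk : 'I_m -> nat, injective rk & exists V, variable_colons A rk V.

(** In a relation expressing ['X_x] times row [j] through its predecessors, keep only the degree 1
    part of the coefficients: the left side has degree [1 + e]. *)
Lemma linear_syzygy e m r (A : 'M[R]_(m, r)) rk V j x :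
    (forall i j, A i j \is e.-homog) -> variable_colons A rk V -> x \in V j ->
  exists b : 'rV[R]_m,
    [/\ b 0 j = 'X_x, forall l, l != j -> (rk j <= rk l)%N -> b 0 l = 0,
        b *m A = 0 & forall l, b 0 l \is 1.-homog].
Proof.
move=> hA lq xV.
have [|c c0 cA] := (lq j 'X_x).1; first by apply: sub_ideal_gen; exists x.
exists (\row_l (if l == j then 'X_x else - pihomog mdeg 1 (c 0 l))); split.
- by rewrite mxE eqxx.
- by move=> l /negPf lj h; rewrite mxE lj c0 // pihomog0 oppr0.
- have cA' i : 'X_x * A j i = \sum_l pihomog mdeg 1 (c 0 l) * A l i.
    move/rowP/(_ i)/(congr1 (pihomog mdeg (1 + e))): cA.
    rewrite !mxE linear_sum /= pihomog_dE; last first.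
      by apply: dhomogM => //; rewrite dhomogX /= mdeg1.
    by move=> ->; apply: eq_bigr => l _; rewrite pihomogM_homog.
  apply/rowP => i; rewrite !mxE (bigD1 j) //= mxE eqxx cA' (bigD1 j) //=.
  rewrite c0 // pihomog0 mul0r add0r -big_split big1 //= => l /negPf lj.
  by rewrite mxE lj mulNr subrr.
- move=> l; rewrite mxE; case: eqP => _; first by rewrite dhomogX /= mdeg1.
  by rewrite dhomogN pihomogP.
Qed.

Lemma syzygy_linear_quotients e m r (A : 'M[R]_(m, r)) :
  has_linear_quotients e A ->
  exists m' (B : 'M[R]_(m', m)),
    has_linear_quotients 1 B /\
    forall v : 'rV_m, v *m A = 0 <-> exists w, v = w *m B.
Proof.
move=> [hA [rk rk_inj [V lq]]].
(* Pairs with [p.2] outside [V p.1] get the dummy value 0, so that [b] is a total family. *)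
have /fin_all_exists2[b _ bP] (p : 'I_m * 'I_n) : exists2 b : 'rV[R]_m, True &
  p.2 \in V p.1 -> [/\ b 0 p.1 = 'X_(p.2),
    forall l, l != p.1 -> (rk p.1 <= rk l)%N -> b 0 l = 0,
    b *m A = 0 & forall l, b 0 l \is 1.-homog].
  case: (boolP (p.2 \in V p.1)) => [/(linear_syzygy hA lq)[b bP]|_].
    by exists b.
  by exists 0.
pose S := [set p : 'I_m * 'I_n | p.2 \in V p.1].
have SP (i : 'I_#|S|) : (enum_val i).2 \in V (enum_val i).1.
  by have := enum_valP i; rewrite inE.
have [b1 b2 b3 b4] : [/\
    forall i : 'I_#|S|, b (enum_val i) 0 (enum_val i).1 = 'X_((enum_val i).2),
    forall (i : 'I_#|S|) l, l != (enum_val i).1 ->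
      (rk (enum_val i).1 <= rk l)%N -> b (enum_val i) 0 l = 0,
    forall i : 'I_#|S|, b (enum_val i) *m A = 0
  & forall (i : 'I_#|S|) l, b (enum_val i) 0 l \is 1.-homog].
  by split=> i; have [] := bP _ (SP i).
pose B := \matrix_(i < #|S|) b (enum_val i).
have BA : B *m A = 0.
  by apply/row_matrixP => i; rewrite row_mul rowK b3 row0.
(* Clear the entries of [v] by decreasing rank: the entry of top rank lies in
     the colon ideal, so a combination of the rows of [B] with that pivot
     removes it. *)
have kerB N (v : 'rV[R]_m) : v *m A = 0 ->
    (forall l, (N <= rk l)%N -> v 0 l = 0) ->
  exists2 w, v = w *m B &
    forall i, (N <= rk (enum_val i).1)%N -> w 0 i = 0.
  elim: N v => [|N IH] v vA v0.
    exists 0 => [|i _]; last by rewrite mxE.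
    by rewrite mul0mx; apply/rowP => l; rewrite v0 ?mxE.
  case: (pickP [pred j | rk j == N]) => [j /eqP jN|noN]; last first.
    have [l hl|w vw w0] := IH v vA.
      by apply: v0; rewrite ltn_neqAle hl eq_sym; have /= -> := noN l.
    by exists w => // i /ltnW/w0.
  (* Solving [v *m A = 0] for row [j] puts [v 0 j] in its colon ideal: entries of rank above [N]
     vanish, and by injectivity only [j] has rank [N]. *)
  have [|h vj] := @var_ideal_sum (V j) (v 0 j).
    apply/lq; exists (\row_l (if l == j then 0 else - v 0 l)).
      move=> l hl; rewrite mxE; case: eqP => // /eqP lj.
      rewrite v0 ?oppr0 // -jN ltn_neqAle hl andbT.
      by apply: contra lj => /eqP/rk_inj->.
    apply/rowP => i; move/rowP/(_ i): vA; rewrite !mxE (bigD1 j) //= => vA.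
    rewrite [RHS](bigD1 j) //= mxE eqxx mul0r add0r.
    move/eqP: vA; rewrite addr_eq0 => /eqP->; rewrite -sumrN.
    by apply: eq_bigr => l /negPf lj; rewrite mxE lj mulNr.
  (* Each [x] in [V j] gives a row of [B] with pivot entry ['X_x] at [j], so [w0 *m B] has entry
     [v 0 j] there and 0 at higher ranks. *)
  pose w0 : 'rV[R]_#|S| :=
    \row_i (if (enum_val i).1 == j then h (enum_val i).2 else 0).
  have [||w vw ww] := IH (v - w0 *m B).
  - by rewrite mulmxBl vA -mulmxA BA mulmx0 subrr.
  - move=> l Nl; rewrite !mxE; have [->|lj] := eqVneq l j; last first.
      have Nl' : (N < rk l)%N.
        rewrite ltn_neqAle Nl andbT -jN.
        by apply: contra lj => /eqP/rk_inj->.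
      rewrite v0 // big1 ?subrr // => i _; rewrite !mxE.
      case: eqP => [ij|_]; last by rewrite mul0r.
      by rewrite b2 ?mulr0 // ij ?jN // ltnW.
    apply/eqP; rewrite subr_eq0 vj; apply/eqP.
    rewrite (eq_bigr (fun i => if (enum_val i).1 == j
                then h (enum_val i).2 * 'X_((enum_val i).2) else 0)).
      rewrite -(big_enum_val (A := mem S) (fun p : 'I_m * 'I_n =>
        if p.1 == j then h p.2 * 'X_(p.2) else 0)).
      rewrite -big_mkcondr /= (reindex_onto (fun x => (j, x)) snd) /=.
        by apply: eq_bigl => x; rewrite !inE !eqxx !andbT.
      by move=> [? ?] /= /andP[_ /eqP->].
    move=> i _; rewrite !mxE; case: eqP => [ij|_]; last by rewrite mul0r.
    by rewrite -ij b1.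
  - exists (w + w0); first by rewrite mulmxDl -vw subrK.
    move=> i hi; rewrite !mxE ww ?(ltnW hi) // add0r.
    by case: eqP => // ij; rewrite ij jN ltnn in hi.
exists #|S|, B; split; last first.
  move=> v; split=> [vA|[w ->]]; last by rewrite -mulmxA BA mulmx0.
  have [|w vw _] := kerB (\max_l rk l).+1 v vA.
    by move=> l; rewrite ltnNge leq_bigmax.
  by exists w.
split; first by move=> i j; rewrite mxE b4.
(* The lexicographic order on pairs as a number: the variable index stays below [n]. *)
exists (fun i : 'I_#|S| => rk (enum_val i).1 * n + (enum_val i).2)%N.
  move=> i1 i2 eqrk; apply: enum_val_inj.
  case: (enum_val i1) (enum_val i2) eqrk => [j1 x1] [j2 x2] /= eqrk.
  have [l1 l2] := (ltn_ord x1, ltn_ord x2).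
  have rkj : rk j1 = rk j2 by nia.
  rewrite (rk_inj _ _ rkj); congr (_, _); apply: val_inj.
  by move: eqrk; rewrite rkj => /addnI.
exists (fun i : 'I_#|S| =>
  [set y in V (enum_val i).1 | (y < (enum_val i).2)%N]) => i g.
have rowB l : row l B = b (enum_val l) by rewrite rowK.
have le_rk (i1 i2 : 'I_#|S|) : (rk (enum_val i1).1 < rk (enum_val i2).1)%N ->
  (rk (enum_val i1).1 * n + (enum_val i1).2 <
   rk (enum_val i2).1 * n + (enum_val i2).2)%N.
  by have := ltn_ord (enum_val i1).2; nia.
split; last first.
  move=> [c c0 cB].
  (* Compare entries in the pivot column of [i]: an earlier row contributes only if it has the same
     pivot, and then its entry is a smaller variable. So [g] times the variable of [i] lies in the
     ideal, and that variable cancels. *)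
  apply: (@var_ideal_colon _ (enum_val i).2); first by rewrite inE ltnn andbF.
  move/rowP/(_ (enum_val i).1): cB; rewrite rowB !mxE b1 => ->.
  have [V0 VD VM] := var_ideal_ideal
    [set y in V (enum_val i).1 | (y < (enum_val i).2)%N].
  apply: big_ind => // l _; rewrite mxE.
  have [lrk|lrk] := leqP (rk (enum_val i).1 * n + (enum_val i).2)
                         (rk (enum_val l).1 * n + (enum_val l).2).
    by rewrite c0 // mul0r.
  have [li|li] := eqVneq (enum_val l).1 (enum_val i).1; last first.
    rewrite b2 ?mulr0 //; first by rewrite eq_sym.
    by rewrite leqNgt; apply/negP => /le_rk; rewrite ltnNge (ltnW lrk).
  have := b1 l; rewrite li => ->; apply: VM; apply: sub_ideal_gen.
  exists (enum_val l).2 => //.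
  by move: lrk; rewrite inE li ltn_add2l => ->; rewrite -li SP.
pose L f := exists2 c : 'rV[R]_#|S|,
  (forall l : 'I_#|S|, (rk (enum_val i).1 * n + (enum_val i).2 <=
              rk (enum_val l).1 * n + (enum_val l).2)%N -> c 0 l = 0)
  & f *: row i B = c *m B.
apply: (ideal_gen_sub (L := L)) => [|f [y]].
  exact: row_colon_ideal.
rewrite inE => /andP[yV yx] ->.
have yS : ((enum_val i).1, y) \in S by rewrite inE.
pose i' := enum_rank_in yS ((enum_val i).1, y).
have i'E : enum_val i' = ((enum_val i).1, y) by rewrite enum_rankK_in.
(* The pivot entries of this combination cancel, so the bound in [kerB] expresses it through rows of
   strictly smaller pivot rank, all preceding [i]. *)
have [||w vw ww] := kerB (rk (enum_val i).1)
    ('X_y *: b (enum_val i) - 'X_((enum_val i).2) *: b (enum_val i')).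
- by rewrite mulmxBl -!scalemxAl !b3 !scaler0 subrr.
- move=> l hl; rewrite !mxE; have [->|lj] := eqVneq l (enum_val i).1.
    by rewrite b1; have := b1 i'; rewrite i'E /= => ->; rewrite mulrC subrr.
  by rewrite !b2 ?i'E // !mulr0 subrr.
exists ('X_((enum_val i).2) *: delta_mx 0 i' + w).
  move=> l hl; rewrite !mxE ww; last first.
    by rewrite leqNgt; apply/negP => /le_rk; rewrite ltnNge hl.
  rewrite eqxx /=; case: eqP => [li|]; last by rewrite mulr0 addr0.
  by move: hl; rewrite li i'E /= leq_add2l leqNgt yx.
by rewrite mulmxDl -scalemxAl -rowE !rowB -vw addrC subrK.
Qed.

End LinearQuotients.

(** * The order on monomials and its exchange property *)

Section Exchange.
Variables (n : nat) (J K : {set 'I_n}) (a b : nat).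
Local Open Scope nat_scope.
Implicit Types (u v w : 'X_{1..n}).

Definition in_cap u := (a <= subdeg J u)%N && (b <= subdeg K u)%N.

(** Degrees are taken on complements so that the smaller number always comes first; at equal total
    degree, a small degree off [C] is a large degree on [C]. *)
Definition precedes v u :=
  let deg_out C := (subdeg (~: C) v, subdeg (~: C) u) in
  let: (t, t') := deg_out (J :|: K) in
  let: (p, p') := deg_out (J :&: K) in
  let: (q, q') := deg_out (J :\: K) in
  (t < t')%N || ((t == t') &&
    ((p < p')%N || ((p == p') &&
      ((q < q')%N || ((q == q') && (u < v)%O))))).

Lemma precedesxx u : precedes u u = false.
Proof. by rewrite /precedes !ltnn !eqxx ltxx. Qed.

Lemma precedes_trans : transitive precedes.
Proof.
move=> v u w; rewrite /precedes.
have := @lt_trans _ _ v u w.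
have := @lt_trans _ _ v w u.
case: (v < w)%O; case: (u < v)%O; case: (w < v)%O; case: (v < u)%O;
case: (u < w)%O; case: (w < u)%O => /= h1 h2;
try (by have := h1 isT isT); try (by have := h2 isT isT); lia.
Qed.

Lemma precedes_total u v : [|| u == v, precedes u v | precedes v u].
Proof.
rewrite /precedes; case: (ltgtP u v) => //=; lia.
Qed.

(** The hypothesis says [w = u * x / y] additively, avoiding truncated subtraction of exponents. *)
Lemma subdeg_exchange u v x y w C : (w + U_(y) = u + U_(x))%MM ->
  (subdeg C w + (y \in C) = subdeg C u + (x \in C))%N.
Proof. by move/(congr1 (subdeg C)); rewrite !subdegD !subdegU. Qed.

(** Equal total degrees turn a surplus of [u] off [C] into a deficit on [C]. *)
Lemma exchange_exists u v C : mdeg u = mdeg v ->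
    (subdeg (~: C) v < subdeg (~: C) u)%N ->
  exists x y, [/\ x \in C, y \notin C, (u x < v x)%N & (v y < u y)%N].
Proof.
move=> duv h; have [y yC vy] := subdeg_lt h.
have [|x xC ux] := @subdeg_lt _ C u v.
  by have := subdegC C u; have := subdegC C v; lia.
by exists x, y; split=> //; rewrite -in_setC.
Qed.

Lemma subdeg_exchange_eq u v C x : subdeg C u = subdeg C v ->
  x \in C -> (u x < v x)%N -> exists2 y, y \in C & (v y < u y)%N.
Proof.
move=> eqC xC uvx; have [|y /setD1P[_ yC] vuy] := @subdeg_lt _ (C :\ x) v u.
  move: eqC; rewrite /subdeg (big_setD1 x xC) [RHS](big_setD1 x xC) /=; lia.
by exists y.
Qed.

(** The first criterion separating [v] from [u] decides from which of the regions cut out by [J] and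
    [K] the variables [x] and [y] are taken. *)
Lemma precedes_exchange u v : mdeg u = mdeg v -> in_cap u -> in_cap v ->
    precedes v u ->
  exists x y w, [/\ (u x < v x)%N, (w + U_(y) = u + U_(x))%MM,
                    in_cap w & precedes w u].
Proof.
move=> duv cu cv.
have regions m : [/\ subdeg J m = subdeg (J :&: K) m + subdeg (J :\: K) m,
    subdeg K m = subdeg (J :&: K) m + subdeg (K :\: J) m,
    subdeg (J :&: K) m + subdeg (~: (J :&: K)) m = mdeg m,
    subdeg (J :\: K) m + subdeg (~: (J :\: K)) m = mdeg m
  & subdeg (J :&: K) m + subdeg (J :\: K) m + subdeg (K :\: J) m
    + subdeg (~: (J :|: K)) m = mdeg m]%N.
  split; rewrite ?subdegC -?subdegID //; first by rewrite setIC -subdegID.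
  rewrite -(subdegC (J :|: K)) (subdegID J (J :|: K)) setUK setDUl setDv.
  by rewrite set0U.
(* The exchanged monomial exists because [v y < u y] makes the exponent of [y] in [u] positive. *)
suff step x y : (u x < v x)%N -> (v y < u y)%N ->
    (forall w, (w + U_(y) = u + U_(x))%MM -> in_cap w /\ precedes w u) ->
  exists x y w, [/\ (u x < v x)%N, (w + U_(y) = u + U_(x))%MM,
                    in_cap w & precedes w u].
  have degs w x y : (w + U_(y) = u + U_(x))%MM ->
    [/\ mdeg w = mdeg u,
      subdeg (J :&: K) w + ((y \in J) && (y \in K)) =
        subdeg (J :&: K) u + ((x \in J) && (x \in K)),
      subdeg (J :\: K) w + ((y \notin K) && (y \in J)) =
        subdeg (J :\: K) u + ((x \notin K) && (x \in J))
    & subdeg (K :\: J) w + ((y \notin J) && (y \in K)) =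
        subdeg (K :\: J) u + ((x \notin J) && (x \in K))]%N.
    move=> h; split; rewrite -?(in_setI, in_setD); try exact: subdeg_exchange.
    by move/(congr1 mdeg): h; rewrite !mdegD !mdeg1 => /addIn.
  move: cu cv; rewrite /in_cap => /andP[cuJ cuK] /andP[cvJ cvK].
  have [u1 u2 u3 u4 u5] := regions u; have [v1 v2 v3 v4 v5] := regions v.
  rewrite {1}/precedes => /orP[lt_t|/andP[/eqP eq_t]].
    (* Removing [y] outside [J :|: K] costs neither degree bound anything. *)
    have [x [y [xC yC ux vy]]] := exchange_exists duv lt_t.
    apply: (step x y) => // w /degs[w0 w1 w2 w3].
    have [r1 r2 r3 r4 r5] := regions w.
    move: xC yC w1 w2 w3; rewrite !inE.
    case: (x \in J) (x \in K) (y \in J) (y \in K) => [] [] [] [] //= *;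
    rewrite /in_cap /precedes; split; lia.
  move=> /orP[lt_p|/andP[/eqP eq_p]].
    (* Since [x] counts for both [J] and [K], it makes up for removing [y]. If [y] is outside
       [J :|: K] the first criterion improves, otherwise the second. *)
    have [x [y [xC yC ux vy]]] := exchange_exists duv lt_p.
    apply: (step x y) => // w /degs[w0 w1 w2 w3].
    have [r1 r2 r3 r4 r5] := regions w.
    move: xC yC w1 w2 w3; rewrite !inE.
    case: (x \in J) (x \in K) (y \in J) (y \in K) => [] [] [] [] //= *;
    rewrite /in_cap /precedes; split; lia.
  move=> /orP[lt_q|/andP[/eqP eq_q uv]].
    (* Now [v] has more in [J :\: K] and less in [K :\: J]. Hence the [K]-degree of [u] exceeds that
       of [v], so exceeds [b], and [u] can lose a variable of [K]. *)
    have [x xC ux] : exists2 x, x \in J :\: K & (u x < v x)%N.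
      by apply: subdeg_lt; lia.
    have [y yC vy] : exists2 y, y \in K :\: J & (v y < u y)%N.
      by apply: subdeg_lt; lia.
    apply: (step x y) => // w /degs[w0 w1 w2 w3].
    have [r1 r2 r3 r4 r5] := regions w.
    move: xC yC w1 w2 w3; rewrite !inE.
    case: (x \in J) (x \in K) (y \in J) (y \in K) => [] [] [] [] //= *;
    rewrite /in_cap /precedes; split; lia.
  (* All region degrees agree; with [x] the first index where [u] and [v] differ, a [y] from the
     same region keeps them unchanged. *)
  have [x eqx ux] := ltmcP duv uv.
  have [y yx vy] : exists2 y,
      (y \in J) = (x \in J) /\ (y \in K) = (x \in K) & (v y < u y)%N.
    have : [|| x \in J :&: K, x \in J :\: K, x \in K :\: J
             | x \in ~: (J :|: K)].
      by rewrite !inE; case: (x \in J) (x \in K) => [] [].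
    by case/or4P => xC; (have [|y yC vy] := subdeg_exchange_eq _ xC ux;
      [lia | exists y => //; move: xC yC; rewrite !inE;
       case: (x \in J) (x \in K) (y \in J) (y \in K) => [] [] [] []]).
  apply: (step x y) => // w wE; have /degs[w0 w1 w2 w3] := wE.
  (* As [u] and [v] agree before [x], the index [y] comes after [x], so the exchange raises the
     first exponent it changes. *)
  have uw : (u < w)%O.
    apply/ltmcP; first by rewrite w0.
    have wi i : (w i + (y == i) = u i + (x == i))%N.
      by rewrite -!mnm1E -!mnmDE wE.
    exists x => [i ix|].
      have [yi|yi] := eqVneq y i.
        by rewrite -yi in ix; have := eqx _ ix; lia.
      have := wi i; rewrite (negPf yi) -[x == i]/(x == i :> nat) gtn_eqF //.
      lia.
    have := wi x; rewrite eqxx; case: (eqVneq y x) => [yx'|_]; last by lia.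
    by move: vy; rewrite yx'; lia.
  have [r1 r2 r3 r4 r5] := regions w.
  move: w1 w2 w3; case: yx => -> -> w1 w2 w3.
  by rewrite /in_cap /precedes uw; split; lia.
move=> ux vy hw; pose w := (u - U_(y) + U_(x))%MM.
have wE : (w + U_(y) = u + U_(x))%MM.
  rewrite /w -addmA [(U_(x) + _)%MM]addmC addmA mnm_subK1 //.
  exact: leq_ltn_trans vy.
by have [] := hw w wE; exists x, y, w.
Qed.

End Exchange.

(** * From the exchange property to linear quotients *)

Section MonomialQuotients.
Variables (k : fieldType) (n : nat).
Local Notation R := {mpoly k[n]}.

(** An exchange gives ['X_x * 'X_[u i] = 'X_y * 'X_[u l]], putting ['X_x] in the colon ideal.
    Conversely, if an earlier [u j] divides [u i + m'], then [u i x < u j x] forces [x] to divide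
    [m']. *)
Lemma exchange_linear_quotients d m (u : 'I_m -> 'X_{1..n}) (rk : 'I_m -> nat) :
    injective rk -> (forall i, mdeg (u i) = d) ->
    (forall i j, (rk j < rk i)%N -> exists x y l,
       [/\ (u i x < u j x)%N, (u l + U_(y) = u i + U_(x))%MM
         & (rk l < rk i)%N]) ->
  has_linear_quotients d (\col_i 'X_[u i] : 'cV[R]_m).
Proof.
move=> rk_inj du exch; split=> [i j|]; first by rewrite mxE dhomogX /= du.
exists rk => //; exists (fun i => [set x | [exists y, exists l,
  (u l + U_(y) == u i + U_(x))%MM && (rk l < rk i)%N]]) => i g.
split.
  pose L f := exists2 c : 'rV[R]_m,
    (forall l, (rk i <= rk l)%N -> c 0 l = 0)
    & f *: row i (\col_i 'X_[u i] : 'cV[R]_m) = c *m (\col_i 'X_[u i]).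
  apply: (ideal_gen_sub (L := L)) => [|_ [x xV ->]].
    exact: row_colon_ideal.
  move: xV; rewrite inE => /existsP[y /existsP[l /andP[/eqP eqm rkl]]].
  exists ('X_y *: delta_mx 0 l) => [l' hl|].
    rewrite !mxE eqxx /=; case: eqP => [l'l|]; last by rewrite mulr0.
    by move: hl; rewrite l'l leqNgt rkl.
  rewrite -scalemxAl -rowE; apply/rowP => o; rewrite !mxE -!mpolyXD.
  by rewrite addmC -eqm addmC.
move=> [c c0 /rowP/(_ 0)]; rewrite !mxE => gE.
apply/var_idealE => m' m'g.
have : (u i + m')%MM \in msupp (\sum_j c 0 j * 'X_[u j]).
  have -> : \sum_j c 0 j * 'X_[u j] = g * 'X_[u i].
    by rewrite gE; apply: eq_bigr => j _; rewrite mxE.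
  by rewrite (perm_mem (msuppMX _ _)); apply/mapP; exists m'.
move/msupp_sum_le/flattenP => [_ /mapP[j _ ->]].
have [rkj|rkj] := leqP (rk i) (rk j); first by rewrite c0 // mul0r msupp0.
rewrite (perm_mem (msuppMX _ _)) => /mapP[m2 _ eqm].
have [x [y [l [ux eqy rkl]]]] := exch i j rkj.
exists x.
  rewrite inE; apply/existsP; exists y; apply/existsP; exists l.
  by rewrite eqy eqxx.
move/(congr1 (fun m : 'X_{1..n} => m x)): eqm; rewrite !mnmDE; lia.
Qed.

End MonomialQuotients.

(** * Iterated syzygies and the linear resolution *)

Section Resolution.
Variables (k : fieldType) (n : nat).
Local Notation R := {mpoly k[n]}.

(** Bundling the sizes allows recursion over matrices of varying dimensions. *)
Record stage := Stage {
  stage_rows : nat;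
  stage_cols : nat;
  stage_mx :> 'M[R]_(stage_rows, stage_cols);
  stage_deg : nat;
  stageP : has_linear_quotients stage_deg stage_mx
}.

Definition syzygy_stage (A : stage) m' (B : 'M[R]_(m', stage_rows A)) :=
  has_linear_quotients 1 B /\
  forall v : 'rV_(stage_rows A), v *m A = 0 <-> exists w, v = w *m B.

Lemma next_stage_exists (A : stage) :
  {B : {m' : nat & 'M[R]_(m', stage_rows A)} | syzygy_stage (tagged B)}.
Proof.
apply: constructive_indefinite_description.
have [m' [B BP]] := syzygy_linear_quotients (stageP A).
by exists (existT _ m' B).
Qed.

Definition next_stage (A : stage) : stage :=
  Stage (svalP (next_stage_exists A)).1.

Lemma next_stageP (A : stage) (v : 'rV_(stage_rows A)) :
  v *m A = 0 <-> exists w, v = w *m (next_stage A : 'M_(_, stage_rows A)).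
Proof. exact: (svalP (next_stage_exists A)).2. Qed.

Section Stages.
Variables (d m : nat) (A : 'cV[R]_m) (AP : has_linear_quotients d A).

Fixpoint stages i := if i is i'.+1 then next_stage (stages i') else Stage AP.

(** Stage 0 is the augmentation, so differential [i] is stage [i.+1]; its entries being linear, the
    generators of the [i]-th module all sit in degree [i + d]. *)
Definition stage_complex : free_complex k n :=
  @FreeComplex k n (fun i => stage_rows (stages i)) (fun i _ => (i + d)%N)
    (fun i => stages i.+1) A.

Lemma stage_complex_resolution (L : R -> Prop) :
    (forall f, L f <-> exists v : 'rV_m, f = (v *m A) 0 0) ->
  minimal_graded_free_resolution stage_complex L.
Proof.
move=> LA.
have diff1 i p q : res_diff stage_complex i p q \is 1.-homog.
  exact: (svalP (next_stage_exists (stages i))).1.1.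
split.
- split=> [p|i p q]; first exact: AP.1.
  rewrite /= leq_add2r leqnSn addSn subSn // subnn; exact: diff1.
- split=> // [v|i v]; first exact: (@next_stageP (Stage AP)).
  exact: (@next_stageP (stages i.+1)).
(* Minimality: every term of a linear form is a multiple of a variable. *)
- move=> i p q; apply/var_idealE => m' /(dhomog_mf (diff1 i p q))/eqP/mdeg1P.
  by move=> [x /eqP->]; exists x; rewrite ?inE ?mnm1E ?eqxx.
Qed.

Lemma linear_quotients_betti (L : R -> Prop) i j :
    (forall f, L f <-> exists v : 'rV_m, f = (v *m A) 0 0) ->
  j != (i + d)%N -> graded_betti L i j 0.
Proof.
move=> LA jid; exists stage_complex; first exact: stage_complex_resolution.
apply/eqP; rewrite cards_eq0 -subset0; apply/subsetP => p.
by rewrite inE eq_sym (negPf jid).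
Qed.

End Stages.
End Resolution.

(** * Ranking the generators, and componentwise linearity of the intersection *)

Lemma ltn_card_predecessors (T : finType) (lt : rel T) :
    irreflexive lt -> transitive lt ->
    (forall x y, [|| x == y, lt x y | lt y x]) ->
  forall x y, (#|[set z | lt z x]| < #|[set z | lt z y]|)%N = lt x y.
Proof.
move=> irr tr tot.
have mono x y : lt x y -> (#|[set z | lt z x]| < #|[set z | lt z y]|)%N.
  move=> xy; apply/proper_card/properP; split.
    by apply/subsetP => z; rewrite !inE => /tr; apply.
  by exists x; rewrite !inE ?irr.
move=> x y; apply/idP/idP => [|/mono//]; have /or3P[/eqP->|//|/mono] := tot x y.
  by rewrite ltnn.
by case: ltngtP.
Qed.

Lemma homogeneous_ideal_iff (k : fieldType) n (L L' : {mpoly k[n]} -> Prop) :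
  (forall f, L f <-> L' f) -> homogeneous_ideal L' -> homogeneous_ideal L.
Proof.
move=> LL' [[L0 LD LM] Lh]; split.
  split=> [|f g|f g]; rewrite !LL'; [exact: L0 | exact: LD | exact: LM].
by move=> f d; rewrite !LL'; apply: Lh.
Qed.

Theorem corollary3p2 (k : fieldType) (n : nat) (J K : {set 'I_n}) (a b : nat)
    (hJ : J != set0) (hK : K != set0) (ha : (0 < a)%N) (hb : (0 < b)%N) :
  componentwise_linear
    (ideal_cap (ideal_pow (var_ideal k J) a) (ideal_pow (var_ideal k K) b)).
Proof.
set I := ideal_cap _ _.
have IE (f : {mpoly k[n]}) : I f <-> monomial_ideal (in_cap J K a b) f.
  rewrite /I /ideal_cap !ideal_pow_varE.
  by split=> [[fJ fK] m mf|h]; [apply/andP; auto | split=> m /h /andP[]].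
have up : upward_closed (in_cap J K a b).
  move=> m u /andP[uJ uK].
  by rewrite /in_cap !subdegD !(leq_trans _ (leq_addl _ _)).
split=> [|d].
  by apply: (homogeneous_ideal_iff IE); apply: monomial_ideal_homogeneous.
have IdE f := degree_idealE d f up IE.
(* Monomials of degree below [d.+1] form a finite type, so the degree [d] generators can be
   enumerated. *)
pose S := [set u : 'X_{1..n < d.+1} | (mdeg u == d) && in_cap J K a b u].
pose u (i : 'I_#|S|) : 'X_{1..n} := enum_val i.
have [du cu] : (forall i, mdeg (u i) = d) /\ (forall i, in_cap J K a b (u i)).
  by split=> i; have := enum_valP i; rewrite inE => /andP[/eqP].
have uS w : mdeg w = d -> in_cap J K a b w -> exists i, u i = w.
  move=> dw cw; have wd : (mdeg w < d.+1)%N by rewrite dw.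
  have wS : BMultinom wd \in S by rewrite inE /= dw eqxx.
  by exists (enum_rank_in wS (BMultinom wd)); rewrite /u enum_rankK_in.
(* Counting predecessors turns the order into the numerical rank that linear quotients require. *)
pose rk i := #|[set v : 'I_#|S| | precedes J K (u v) (u i)]|.
have rkE i j : (rk i < rk j)%N = precedes J K (u i) (u j).
  apply: (ltn_card_predecessors (lt := fun i j => precedes J K (u i) (u j))).
  - by move=> x; apply: precedesxx.
  - by move=> x y z; apply: precedes_trans.
  - move=> x y; have := precedes_total J K (u x) (u y).
    by rewrite (inj_eq (inj_comp val_inj enum_val_inj)).
have lq : has_linear_quotients d (\col_i 'X_[u i] : 'cV[{mpoly k[n]}]_#|S|).
  apply: (@exchange_linear_quotients _ _ _ _ _ rk) => // [i j eq_rk|i j].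
    have := precedes_total J K (u i) (u j); rewrite -!rkE eq_rk ltnn !orbF.
    by move/eqP/val_inj/enum_val_inj.
  rewrite rkE => ji.
  have [|x [y [w [ux wE cw wi]]]] := precedes_exchange _ (cu i) (cu j) ji.
    by rewrite !du.
  (* An exchange preserves total degree, so [w] is again an enumerated generator. *)
  have [|l lw] := uS w _ cw; last by exists x, y, l; rewrite rkE lw.
  by move/(congr1 mdeg): wE; rewrite !mdegD !mdeg1 du => /addIn.
have gens f : degree_ideal d I f <->
    exists v : 'rV_#|S|, f = (v *m \col_i 'X_[u i]) 0 0.
  split.
    move/IdE.
    apply: (monomial_ideal_sub (L := fun f => exists v : 'rV_#|S|,
      f = (v *m \col_i 'X_[u i]) 0 0)) => [|m [w [dw cw wm]]].
      split=> [|_ _ [v ->] [w ->]|g _ [v ->]].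
      - by exists 0; rewrite mul0mx mxE.
      - by exists (v + w); rewrite mulmxDl [RHS]mxE.
      - by exists (g *: v); rewrite -scalemxAl [RHS]mxE.
    have [i wi] := uS w dw cw; exists ('X_[m - w] *: delta_mx 0 i).
    by rewrite -scalemxAl -rowE !mxE wi -mpolyXD submK.
  move=> [v ->]; have [L0 LD LM] :=
    ideal_gen_ideal (fun f => I f /\ f \is d.-homog).
  rewrite mxE; apply: big_ind => // i _; apply: LM; apply: sub_ideal_gen.
  by rewrite mxE IE monomial_idealX dhomogX /= du.
split.
- apply: (homogeneous_ideal_iff IdE); apply: monomial_ideal_homogeneous.
  move=> m v [w [dw cw wv]]; exists w; split=> //.
  exact: lepm_trans wv (lem_addl _ _).
- exact: degree_ideal_generated.
- by move=> i j jid; apply: (linear_quotients_betti lq gens jid).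
Qed.
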